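(* Let $X$ be a finite graph. The following assertions are equivalent: (i) $\mathrm{mdeg}(X)=|V(X)|$; (ii) up to isomorphism, there exists a unique median graph whose crossing graph is isomorphic to $X$, namely $\mathrm{Simp}(X)$; (iii) $X$ cannot be separated by the star of one of its vertices, i.e. there is no vertex $x\in V(X)$ such that $X\setminus \mathrm{star}(x)$ has at least two connected components.
   Context: Graphs are simple and undirected. A connected graph $M$ with graph metric $d$ is median if for all vertices $x_1,x_2,x_3$ there is a unique vertex $m$ with $d(x_i,x_j)=d(x_i,m)+d(m,x_j)$ for all $i\neq j$. Two edges $\{a,b\},\{x,y\}$ of a connected graph are in $\Theta$-relation if $d(a,x)+d(b,y)\neq d(a,y)+d(b,x)$. In a median graph $\Theta$ is an equivalence relation on edges, the reflexive-transitive closure of ''being opposite edges of a square'' (square = induced 4-cycle). Two distinct $\Theta$-classes cross if they both contain an edge of a common square. The crossing graph $\mathrm{Cross}(M)$ has as vertices the $\Theta$-classes of $M$, two $\Theta$-classes being adjacent when they cross. The degree $\deg(G)$ of a graph $G$ is the supremum of the degrees of its vertices. The median degree $\mathrm{mdeg}(X)$ of a graph $X$ is the smallest degree of a median graph $M$ with $\mathrm{Cross}(M)\simeq X$ (it is known that such an $M$ always exists). The simplex graph $\mathrm{Simp}(X)$ is the graph whose vertices are the (possibly empty) cliques of $X$ and whose edges connect two cliques whenever one is obtained from the other by adding or removing a single vertex; it is known to be a median graph with crossing graph isomorphic to $X$. The star $\mathrm{star}(x)$ of a vertex $x$ is the subgraph induced by $x$ and its neighbours, and $X\setminus\mathrm{star}(x)$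 is the subgraph induced by the vertices not in $\mathrm{star}(x)$. *)

(* Defs.v *)
(* Mathematical Components with the classical sets of MathComp-Analysis. *)
From mathcomp Require Import all_boot.
From mathcomp Require Import boolp classical_sets functions cardinality.

Set Implicit Arguments.
Unset Strict Implicit.
Unset Printing Implicit Defensive.

Local Open Scope classical_set_scope.
Local Open Scope card_scope.

(* The vertex type is arbitrary, so a graph may be infinite; a finite graph is
   an [sgraph V] with [V : finType]. *)
Record sgraph (V : Type) := SGraph {
  adj : V -> V -> Prop;
  adj_sym : forall x y, adj x y -> adj y x;
  adj_irrefl : forall x, ~ adj x x }.

Definition graph_iso (V W : Type) (G : sgraph V) (H : sgraph W) : Prop :=
  exists2 f : V -> W,
    bijective f & forall x y, adj G x y <-> adj H (f x) (f y).

Section Induced.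
Variables (V : Type) (G : sgraph V) (A : set V).

Definition induced_adj (x y : A) : Prop := adj G (val x) (val y).

Lemma induced_sym x y : induced_adj x y -> induced_adj y x.
Proof. exact: adj_sym. Qed.

Lemma induced_irrefl x : ~ induced_adj x x.
Proof. exact: adj_irrefl. Qed.

Definition induced : sgraph A := SGraph induced_sym induced_irrefl.

End Induced.

Section Metric.
Variables (V : Type) (G : sgraph V).

Fixpoint walk (n : nat) (x y : V) : Prop :=
  if n is m.+1 then exists2 z, adj G x z & walk m z y else x = y.

(* The value is the junk 0 when no walk joins x to y. *)
Definition dist (x y : V) : nat :=
  xget 0 [set n | walk n x y /\ forall m, walk m x y -> n <= m].

(* The graph without vertices does not count as connected. *)
Definition connected_graph : Prop :=
  inhabited V /\ forall x y, exists n, walk n x y.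

Definition components : set (set V) :=
  [set C | exists x, C = [set y | exists n, walk n x y]].

Definition median_graph : Prop :=
  connected_graph /\
  forall x1 x2 x3, exists! m,
    [/\ dist x1 x2 = dist x1 m + dist m x2,
        dist x2 x3 = dist x2 m + dist m x3 &
        dist x1 x3 = dist x1 m + dist m x3].

Definition star (x : V) : set V := [set y | y = x \/ adj G x y].

Definition degree_le (n : nat) : Prop := forall v, [set w | adj G v w] #<= `I_n.

(* The supremum of the vertex degrees is the finite number n; no n qualifies
   when this supremum is infinite. *)
Definition is_degree (n : nat) : Prop :=
  degree_le n /\ forall k, degree_le k -> n <= k.

End Metric.

Section Crossing.
Variables (V : Type) (M : sgraph V).

Definition edges : set (set V) :=
  [set e | exists a b, adj M a b /\ e = [set a; b]].

Definition Theta (e f : set V) : Prop :=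
  exists a b x y,
    [/\ adj M a b, adj M x y, e = [set a; b], f = [set x; y] &
        dist M a x + dist M b y <> dist M a y + dist M b x].

(* Theta is transitive when M is median, the only case in which these sets and
   the graph [cross] below are meant to be used. *)
Definition Theta_classes : set (set (set V)) :=
  [set C | exists2 e, edges e & C = [set f | Theta e f]].

Definition square (a b c d : V) : Prop :=
  [/\ adj M a b, adj M b c, adj M c d & adj M d a] /\
  [/\ a <> c, b <> d, ~ adj M a c & ~ adj M b d].

Definition square_edges (a b c d : V) : set (set V) :=
  [set e | [\/ e = [set a; b], e = [set b; c], e = [set c; d] | e = [set d; a]]].

Definition cross_adj (C D : Theta_classes) : Prop :=
  C <> D /\
  exists a b c d,
    [/\ square a b c d,
        square_edges a b c d `&` val C !=set0 &
        square_edges a b c d `&` val D !=set0].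

Lemma cross_sym C D : cross_adj C D -> cross_adj D C.
Proof.
case=> CD [a [b [c [d [sq hC hD]]]]].
by split; [exact: nesym | exists a, b, c, d].
Qed.

Lemma cross_irrefl C : ~ cross_adj C C.
Proof. by case. Qed.

Definition cross : sgraph Theta_classes := SGraph cross_sym cross_irrefl.

End Crossing.

Section Simplex.
Variables (V : finType) (X : sgraph V).

Definition cliques : set {set V} :=
  [set K | forall x y, x \in K -> y \in K -> x <> y -> adj X x y].

Definition simp_adj (K L : cliques) : Prop :=
  exists x, (x \notin val K /\ val L = (x |: val K)%SET) \/
            (x \notin val L /\ val K = (x |: val L)%SET).

Lemma simp_sym K L : simp_adj K L -> simp_adj L K.
Proof. by case=> x [h|h]; exists x; [right|left]. Qed.

Lemma simp_irrefl K : ~ simp_adj K K.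
Proof. by case=> x [] [/negP xK eK]; apply: xK; rewrite eK finset.setU11. Qed.

Definition simp : sgraph cliques := SGraph simp_sym simp_irrefl.

End Simplex.

(* The median degree of X is the natural number n.  Graphs of infinite degree
   cannot lower the minimum, so only finite degrees are compared with n. *)
Definition is_mdeg (V : Type) (X : sgraph V) (n : nat) : Prop :=
  (exists (W : Type) (M : sgraph W),
     [/\ median_graph M, graph_iso (cross M) X & is_degree M n]) /\
  (forall (W : Type) (M : sgraph W) (k : nat),
     median_graph M -> graph_iso (cross M) X -> is_degree M k -> n <= k).

Definition star_separates (V : Type) (X : sgraph V) (x : V) : Prop :=
  exists C D, [/\ components (induced X (~` star X x)) C,
                  components (induced X (~` star X x)) D & C <> D].

(* Main.v *)
Require Import Defs.
From mathcomp Require Import all_boot.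
From mathcomp Require Import boolp classical_sets functions cardinality.
From mathcomp Require Import zify.

(** The three assertions are proved equivalent in the cycle (iii), (ii), (i),
    (iii), by giving the vertices of median graphs 0/1 coordinates.

    Coordinates.  In a median graph M an edge ab splits the vertices into those
    closer to a and those closer to b, and the split depends only on the
    Theta-class of ab ([closer_ladder], [separates_eq]).  Suppose that
    Cross(M) = X is finite.  Recording on which side of each class a vertex
    lies embeds M isometrically in the hypercube {0,1}^V
    ([median_crossing_coordinates]): a geodesic crosses each class at most once.
    Medians become coordinatewise majorities, edges of the class x flip exactly
    the coordinate x, and two classes cross if and only if the four
    combinations of values of their coordinates all occur
    ([quadrants_square], [square_quadrants]).  Conversely, a median graph with
    isometric coordinates of this kind has crossing graph X
    ([crossing_coordinates_iso]).

    (iii) implies (ii).  If y does not cross x, the edges of the class y all lie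
    on the same side of x, and two crossing classes that both avoid star(x) lie
    on the same side of x ([uncrossed_side_adj]).  As the complement of star(x)
    is connected, there is one side o(x) of x that contains all classes not
    crossing x ([connected_side]).  For two classes that do not cross, the
    combination of the two sides opposite to o is the one that does not occur.
    So the classes at which a vertex v is not on the side o form a clique, and
    v is determined by it.  Every clique arises, because a choice of sides is
    realised by a vertex as soon as it is realised on any two classes
    ([pairwise_realized]).  This identifies M with Simp(X) ([iso_simp]).

    (ii) implies (i).  The empty clique has degree |V| in Simp(X), and no vertex
    has a larger degree, since edges at a vertex flip distinct coordinates.

    (i) implies (iii).  If X minus star(x) is the union of two nonempty parts
    with no edge between them, one of them B, then the class x can be put
    between B and the other part A: the sets K such that K minus x is a clique,
    K avoids A if it contains x, and K avoids B if it does not, form a median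
    graph with crossing graph X.  At each vertex some element of A or of B
    cannot be added, so all degrees are less than |V| ([split_degree]). *)

Set Implicit Arguments.
Unset Strict Implicit.
Unset Printing Implicit Defensive.

Local Open Scope classical_set_scope.
Local Open Scope card_scope.

(** * Graphs and distances *)

Definition in_set_type (T : Type) (A : set T) x (Ax : A x) : A :=
  exist (fun y => y \in A) x (mem_set Ax).

Lemma set2_eq (T : Type) (a b x y : T) : [set a; b] = [set x; y] ->
  (a = x /\ b = y) \/ (a = y /\ b = x).
Proof.
move=> E; have /= ha : [set x; y] a by rewrite -E; left.
have /= hb : [set x; y] b by rewrite -E; right.
have /= hx : [set a; b] x by rewrite E; left.
have /= hy : [set a; b] y by rewrite E; right.
case: ha hb hx hy => -> [] ->; try (by left); try by right.
  by move=> _ [] ->; left.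
by move=> [] ->; left.
Qed.

Lemma graph_iso_sym (V W : Type) (G : sgraph V) (H : sgraph W) :
  graph_iso G H -> graph_iso H G.
Proof.
case=> f [g fK gK] fE; exists g; first by exists f.
by move=> x y; rewrite fE !gK.
Qed.

Lemma graph_iso_inj_surj (V W : Type) (G : sgraph V) (H : sgraph W)
    (f : V -> W) :
  injective f -> (forall y, exists x, f x = y) ->
  (forall x y, adj G x y <-> adj H (f x) (f y)) -> graph_iso G H.
Proof.
move=> f_inj f_surj fE; exists f => //.
have [g gK] := choice f_surj.
by exists g => // x; apply: f_inj; rewrite gK.
Qed.

Section Walks.
Variables (V : Type) (G : sgraph V).

Lemma walk_cat m n x y z : walk G m x y -> walk G n y z -> walk G (m + n) x z.
Proof.
elim: m x => [|m IHm] x /=; first by move=> ->.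
by case=> t xt ty yz; exists t => //; apply: IHm.
Qed.

Lemma walk_sym n x y : walk G n x y -> walk G n y x.
Proof.
elim: n x => [|n IHn] x; first by move=> /= ->.
case=> z xz /IHn yz; rewrite -addn1; apply: walk_cat yz _.
by exists x => //; apply: adj_sym.
Qed.

End Walks.

Section Distance.
Variables (V : Type) (G : sgraph V).
Hypothesis connG : connected_graph G.
Notation d := (dist G).

Lemma dist_spec x y : walk G (d x y) x y /\ forall m, walk G m x y -> d x y <= m.
Proof.
apply: (@xgetPex _ 0 [set n | walk G n x y /\ forall m, walk G m x y -> n <= m]).
have ex_walk : exists n, `[< walk G n x y >].
  by have [n xy] := connG.2 x y; exists n; apply/asboolP.
have [n /asboolP xy n_min] := ex_minnP ex_walk.
by exists n; split=> // m xym; apply/n_min/asboolP.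
Qed.

Lemma dist_walk x y : walk G (d x y) x y.
Proof. by case: (dist_spec x y). Qed.

Lemma dist_min m x y : walk G m x y -> d x y <= m.
Proof. by case: (dist_spec x y) => _; apply. Qed.

Lemma dist_refl x : d x x = 0.
Proof. by apply/eqP; rewrite -leqn0; apply: (@dist_min 0). Qed.

Lemma dist0_eq x y : d x y = 0 -> x = y.
Proof. by move=> xy; have := dist_walk x y; rewrite xy. Qed.

Lemma dist_sym x y : d x y = d y x.
Proof.
by apply/eqP; rewrite eqn_leq; apply/andP; split; apply/dist_min/walk_sym/dist_walk.
Qed.

Lemma dist_triangle y x z : d x z <= d x y + d y z.
Proof. by apply/dist_min/walk_cat/dist_walk/dist_walk. Qed.

Lemma dist1P x y : d x y = 1 <-> adj G x y.
Proof.
split=> [xy|xy]; first by have := dist_walk x y; rewrite xy /= => -[z xz <-].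
apply/eqP; rewrite eqn_leq (@dist_min 1) /=; last by exists y.
rewrite lt0n; apply/eqP => /dist0_eq eqxy.
by move: xy; rewrite eqxy; apply: adj_irrefl.
Qed.

Lemma dist_step n x y : d x y = n.+1 -> exists2 z, adj G x z & d z y = n.
Proof.
move=> xy; have := dist_walk x y; rewrite xy => -[z xz zy]; exists z => //.
have := dist_triangle z x y; have := dist_min zy.
by rewrite xy (dist1P x z).2 //; lia.
Qed.

End Distance.

(** * Halfspaces and Theta in a median graph *)
Section Halfspaces.
Variables (W : Type) (M : sgraph W).
Hypothesis medM : median_graph M.
Notation d := (dist M).
Let connM := medM.1.
Let dS := dist_sym connM.
Let dT := dist_triangle connM.

Lemma median_exists x y z : exists m,
  [/\ d x y = d x m + d m y, d y z = d y m + d m z & d x z = d x m + d m z].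
Proof. by have [m [mP _]] := medM.2 x y z; exists m. Qed.

Lemma median_unique x y z m m' :
  [/\ d x y = d x m + d m y, d y z = d y m + d m z & d x z = d x m + d m z] ->
  [/\ d x y = d x m' + d m' y, d y z = d y m' + d m' z &
      d x z = d x m' + d m' z] -> m = m'.
Proof. by have [n [_ nU]] := medM.2 x y z => /nU <- /nU <-. Qed.

(** Membership of v in the halfspace of the edge ab on the side of a. *)
Definition closer a b v := d v a < d v b.

(** A median graph is bipartite: the median of v, a, b is an endpoint of the
    edge ab. *)
Lemma dist_edge v a b : adj M a b -> d v b = (d v a).+1 \/ d v a = (d v b).+1.
Proof.
move=> /(dist1P connM) ab.
have [m []] := median_exists v a b; rewrite ab (dS a m).
case ma : (d m a) => [|k].
  by move: (dist0_eq connM ma) => ->; lia.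
case mb : (d m b) => [|l]; last by lia.
by move: (dist0_eq connM mb) => ->; lia.
Qed.

Lemma closerC a b v : adj M a b -> closer b a v = ~~ closer a b v.
Proof. by rewrite /closer => /(dist_edge v) []; lia. Qed.

Lemma closer_refl a b : adj M a b -> closer a b a.
Proof. by move=> /(dist1P connM) ab; rewrite /closer ab (dist_refl connM). Qed.

(** Otherwise a and b' are two distinct medians of v, b and a'. *)
Lemma closer_square a b a' b' v :
  adj M a b -> adj M a' b' -> adj M a a' -> adj M b b' ->
  a <> b' -> a' <> b -> closer a b v -> closer a' b' v.
Proof.
move=> ab ab' aa bb neq neq'.
rewrite /closer => lt; case: (ltnP (d v a') (d v b')) => // ge.
have := dist_edge v ab; have := dist_edge v ab'.
have := dist_edge v aa; have := dist_edge v bb => ebb eaa eab' eab.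
have vE : d v b = d v a' by lia.
have [d1 d2 d3 d4] : [/\ d a b = 1, d a' b' = 1, d a a' = 1 & d b b' = 1].
  by split; apply/(dist1P connM).
have ba2 : d b a' = 2.
  have := dT a b a'; rewrite (dS b a) d1 d3 => le2.
  case E : (d b a') => [|[|k]] //.
  - by case: neq'; rewrite (dist0_eq connM E).
  - by case: (dist_edge v ((dist1P connM _ _).1 E)); lia.
  - by move: le2; rewrite E; lia.
case: neq; apply: (@median_unique v b a');
  rewrite ba2 ?d1 ?d3 ?(dS b a) ?(dS b' b) ?(dS b' a') ?d1 ?d2 ?d3 ?d4; split; lia.
Qed.

(** The edges ab and xy are joined by a ladder of squares, built by induction
    along a geodesic from a to x; each square preserves the halfspaces. *)
Lemma closer_ladder a b x y v :
  adj M a b -> adj M x y -> closer a b x -> closer b a y ->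
  closer a b v = closer x y v.
Proof.
move En : (d a x) => n; elim: n a b En => [|n IHn] a b ax ab xy clx cly.
  have eax := dist0_eq connM ax.
  suff -> : b = y by rewrite eax.
  have := dist1P connM x y; move: cly; rewrite /closer eax => lt [_ /(_ xy)].
  by rewrite dS => yx; apply/esym/(dist0_eq connM); lia.
have [a' aa' a'x] := dist_step connM ax.
rewrite /closer in clx cly.
have ab1 := (dist1P connM _ _).2 ab; have xy1 := (dist1P connM _ _).2 xy.
have aa1 := (dist1P connM _ _).2 aa'.
have xa : d x a = n.+1 by rewrite dS.
have xa' : d x a' = n by rewrite dS.
have xb : d x b = n.+2 by have := dist_edge x ab; lia.
have [yb ya] : d y b = n.+1 /\ d y a = n.+2.
  have := dist_edge y ab; have := dT y x b; have := dT x y a.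
  by rewrite (dS y x); lia.
have ya' : d y a' = n.+1.
  by have := dT x y a'; have := dist_edge y aa'; rewrite (dS y x); lia.
(* The next rung of the ladder: b' completes the square on a', a, b. *)
have [b' [e1 e2 e3]] := median_exists y a' b.
have a'b2 : d a' b = 2.
  have := dT a a' b; rewrite (dS a' a) => le2.
  case E : (d a' b) => [|[|k]] //.
  - by move: xa'; rewrite (dist0_eq connM E); lia.
  - by case: (dist_edge y ((dist1P connM _ _).1 E)); lia.
  - by move: le2; rewrite E; lia.
have a'b' : adj M a' b' by apply/(dist1P connM); rewrite dS; move: (dS a' b'); lia.
have bb' : adj M b b' by apply/(dist1P connM); move: (dS a' b') (dS b b'); lia.
have neq : a <> b' by move=> E; move: e1 ya; rewrite -E; lia.
have neq' : a' <> b by move=> E; move: xa'; rewrite E; lia.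
have -> : closer a b v = closer a' b' v.
  apply/idP/idP; first exact: closer_square.
  by apply: closer_square => //; apply: adj_sym.
have b'a'1 := (dist1P connM _ _).2 a'b'; have bb1 := (dist1P connM _ _).2 bb'.
apply: IHn => //; rewrite /closer.
  by have := dT b' x b; rewrite (dS b' b); lia.
by move: (dS a' b'); lia.
Qed.

Lemma separates_eq a b x y v w :
  adj M a b -> adj M x y -> closer a b x != closer a b y ->
  (closer a b v != closer a b w) = (closer x y v != closer x y w).
Proof.
move=> ab xy; have ba := adj_sym ab.
case clx : (closer a b x); case cly : (closer a b y) => // _.
  have E t : closer a b t = closer x y t.
    by apply: closer_ladder => //; rewrite closerC // cly.
  by rewrite !E.
have E t : ~~ closer a b t = closer x y t.
  by rewrite -closerC //; apply: closer_ladder => //; rewrite closerC // clx.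
by rewrite -!E; case: closer; case: closer.
Qed.

Lemma Theta_separates a b x y : adj M a b -> adj M x y ->
  Theta M [set a; b] [set x; y] <-> closer a b x != closer a b y.
Proof.
move=> ab xy.
have key a' b' x' y' : adj M a' b' -> adj M x' y' ->
    (d a' x' + d b' y' <> d a' y' + d b' x') <-> closer a' b' x' != closer a' b' y'.
  move=> ab' xy'; rewrite /closer !(dS a') !(dS b').
  have := dist_edge x' ab'; have := dist_edge y' ab'.
  by move: (d x' a') (d x' b') (d y' a') (d y' b') => p q r s; lia.
split; last first.
  by move=> sep; exists a, b, x, y; split=> //; apply/key.
case=> a' [b' [x' [y' [ab' xy' e1 e2 /(key _ _ _ _ ab' xy')]]]].
have eab := set2_eq e1; have exy := set2_eq e2.
have swap b1 b2 : (~~ b1 != ~~ b2) = (b1 != b2) by case: b1 b2 => [] [].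
have notC t : closer b' a' t = ~~ closer a' b' t by apply: closerC.
by case: eab exy => -[-> ->] [] [-> ->]; rewrite ?notC ?swap // eq_sym.
Qed.

End Halfspaces.

(** * Majority and Hamming distance *)

Definition maj (T : Type) (f g k : T -> bool) x :=
  (f x && g x) || (k x && (f x || g x)).

(** At least two of f, g, k attain the majority value at x, and at least two
    at y, so one of them attains both.  Hence a family of sets defined by
    conditions on two elements at a time is closed under majority. *)
Lemma maj_pair (T : Type) (f g k : T -> bool) x y :
  let m := maj f g k in
  [\/ m x = f x /\ m y = f y, m x = g x /\ m y = g y |
      m x = k x /\ m y = k y].
Proof.
rewrite /= /maj; case: (f x) (g x) (k x) (f y) (g y) (k y) => [] [] [] [] [] [];
  by [constructor 1|constructor 2|constructor 3].
Qed.

Section Hamming.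
Variable V : finType.
Implicit Types f g k : V -> bool.

Definition hamming f g := \sum_x (f x (+) g x).

Lemma hamming0P f g : hamming f g = 0 -> f =1 g.
Proof.
move=> /eqP; rewrite sum_nat_eq0 => /forallP fg x.
by apply/eqP; move: (fg x) => /=; case: (f x) (g x) => [] [].
Qed.

Lemma hamming1P f g :
  hamming f g = 1 <-> exists x, forall y, f y (+) g y = (y == x).
Proof.
split=> [fg1|[x fg]]; last first.
  rewrite /hamming (bigD1 x) //= fg eqxx big1 // => y /negPf yx.
  by rewrite fg yx.
have [x fgx] : exists x, f x (+) g x.
  apply: contrapT => no; move: fg1; rewrite /hamming big1 // => x _.
  by case E : (_ (+) _) => //; case: no; exists x.
exists x => y; have [->//|yx] := eqVneq y x.
move: fg1; rewrite /hamming (bigD1 x) //= fgx (bigD1 y) //=.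
by case: (_ (+) _).
Qed.

Lemma hamming_triangle f g k : hamming f g <= hamming f k + hamming k g.
Proof.
rewrite /hamming -big_split; apply: leq_sum => x _ /=.
by case: (f x) (g x) (k x) => [] [] [].
Qed.

(** Equality in the triangle inequality forces equality at each coordinate. *)
Lemma hamming_between f g k x :
  hamming f g = hamming f k + hamming k g -> f x = g x -> k x = f x.
Proof.
rewrite /hamming -big_split /= (bigD1 x) //= [RHS](bigD1 x) //= => sumE fgx.
have : \sum_(i | i != x) (f i (+) g i) <=
       \sum_(i | i != x) ((f i (+) k i) + (k i (+) g i)).
  by apply: leq_sum => y _; case: (f y) (g y) (k y) => [] [] [].
by move: sumE; rewrite -fgx; case: (f x) (k x) => [] [] //=; lia.
Qed.

End Hamming.

Lemma toggle_finsetP (V : finType) (A B : {set V}) :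
  (exists x, (x \notin A /\ B = (x |: A)%SET) \/
             (x \notin B /\ A = (x |: B)%SET)) <->
  exists x, forall y, (y \in A) (+) (y \in B) = (y == x).
Proof.
split=> -[x].
  case=> -[xA ->]; exists x => y; rewrite !inE;
    by case: (eqVneq y x) => [->|_]; rewrite ?(negPf xA) //= ?addbb.
move=> AB; exists x; case xA : (x \in A); [right|left].
all: split; first by move: (AB x); rewrite eqxx xA; case: (x \in B).
all: apply/setP => y; rewrite !inE; move: (AB y).
all: by have [->|_] := eqVneq y x; rewrite ?xA //;
  case: (y \in A); case: (y \in B).
Qed.

(** * Isometric coordinates in a hypercube *)

Section Coordinates.
Variables (V : finType) (W : Type) (M : sgraph W) (h : W -> V -> bool).

Definition isometric := forall u v, dist M u v = hamming (h u) (h v).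

Definition flips x u v := forall y, h u y (+) h v y = (y == x).

Definition quadrants x y := forall b c, exists2 v, h v x = b & h v y = c.

(** Here V stands both for the vertices of X and for the Theta-classes of M;
    [h v x] tells the side of the class x on which v lies. *)
Record crossing_coordinates (X : sgraph V) : Prop := {
  coord_isometric : isometric;
  coord_nonconstant : forall x, exists u v, h u x != h v x;
  coord_crossing : forall x y, adj X x y <-> x <> y /\ quadrants x y }.

Hypotheses (medM : median_graph M) (isoM : isometric).
Notation d := (dist M).
Let connM := medM.1.

Lemma coord_inj u v : h u =1 h v -> u = v.
Proof.
move=> huv; apply: (dist0_eq connM); rewrite isoM /hamming big1 // => x _.
by rewrite huv addbb.
Qed.

Lemma adj_flips u v : adj M u v <-> exists x, flips x u v.
Proof. by rewrite -(dist1P connM) isoM; apply: hamming1P. Qed.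

Lemma flips_sym x u v : flips x u v -> flips x v u.
Proof. by move=> uv y; rewrite addbC. Qed.

Lemma flips_uniq x y u v : flips x u v -> h u y != h v y -> y = x.
Proof.
by move=> uv; move: (uv y); case: eqP => // _; case: (h u y) (h v y) => [] [].
Qed.

Lemma flips_trans x u v w : flips x u v -> flips x v w -> u = w.
Proof.
move=> uv vw; apply: coord_inj => y; move: (uv y) (vw y) => <-.
by case: (h u y) (h v y) (h w y) => [] [] [].
Qed.

Lemma between_coord u v m x :
  d u v = d u m + d m v -> h u x = h v x -> h m x = h u x.
Proof. by rewrite !isoM; apply: hamming_between. Qed.

Lemma median_coord u v w : exists2 m,
    [/\ d u v = d u m + d m v, d v w = d v m + d m w & d u w = d u m + d m w] &
    h m =1 maj (h u) (h v) (h w).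
Proof.
have [m mP] := median_exists medM u v w; exists m => // x.
have [/between_coord uv /between_coord vw /between_coord uw] := mP.
move: (uv x) (vw x) (uw x); rewrite /maj.
case: (h u x) (h v x) (h w x) => [] [] [] // e1 e2 e3;
  by [exact: e1|exact: e2|exact: e3].
Qed.

Lemma closer_flips a b x v : flips x a b -> closer M a b v = (h v x == h a x).
Proof.
move=> ab; rewrite /closer !isoM /hamming (bigD1 x) //= [ltnRHS](bigD1 x) //=.
have -> : \sum_(y | y != x) (h v y (+) h b y) = \sum_(y | y != x) (h v y (+) h a y).
  apply: eq_bigr => y /negPf yx; move: (ab y); rewrite yx.
  by case: (h a y) (h b y) => [] [].
by move: (ab x); rewrite eqxx; case: (h v x) (h a x) (h b x) => [] [] [] //= _; lia.
Qed.

Lemma Theta_flips a b c e x y : flips x a b -> flips y c e ->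
  Theta M [set a; b] [set c; e] <-> x = y.
Proof.
move=> ab ce.
rewrite (Theta_separates medM); last 2 first.
- by apply/adj_flips; exists x.
- by apply/adj_flips; exists y.
rewrite !(closer_flips _ ab); split=> [sep|xy].
  by apply: (flips_uniq ce); apply: contraNN sep => /eqP ->.
move: (ce x) (ab x); rewrite -xy eqxx.
by case: (h c x) (h e x) (h a x) (h b x) => [] [] [] [].
Qed.

(** A walk between the two sides of x has to flip x somewhere. *)
Lemma flips_exists x : (exists u v, h u x != h v x) -> exists u v, flips x u v.
Proof.
case=> u [v]; have := dist_walk connM u v.
move: (d u v) => n; elim: n u => [|n IHn] u; first by move=> /= ->; rewrite eqxx.
case=> w uw wv; have [y fuw] := (adj_flips u w).1 uw.
have [<- /(flips_uniq fuw) ->|wvx _] := eqVneq (h w x) (h v x); last exact: IHn wvx.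
by exists u, w.
Qed.

Definition flip_class x : set (set W) :=
  [set e | exists2 p, e = [set p.1; p.2] & flips x p.1 p.2].

Lemma Theta_class_flip_class a b x : flips x a b ->
  [set f | Theta M [set a; b] f] = flip_class x.
Proof.
move=> ab; apply/seteqP; split=> f /=.
  move=> /[dup] -[_ [_ [u [v [_ /adj_flips[y uv] _ -> _]]]]].
  by move=> /(Theta_flips ab uv) ->; exists (u, v).
by case=> [[u v]] /= -> uv; apply/(Theta_flips ab uv).
Qed.

Lemma flip_class_Theta x a b : flips x a b -> Theta_classes M (flip_class x).
Proof.
move=> ab; exists [set a; b]; last by rewrite (Theta_class_flip_class ab).
by exists a, b; split=> //; apply/adj_flips; exists x.
Qed.

Lemma flip_class_inj x y a b : flips x a b -> flip_class x = flip_class y -> x = y.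
Proof.
move=> ab E; have : flip_class y [set a; b] by rewrite -E; exists (a, b).
case=> -[u v] /= eq uv; move: (Theta_class_flip_class uv).
rewrite -E -(Theta_class_flip_class ab) -eq => _.
by apply/(Theta_flips ab uv); rewrite -eq; apply/(Theta_flips ab ab).
Qed.

Lemma Theta_classP C : Theta_classes M C -> exists x, C = flip_class x.
Proof.
case=> _ [a [b [/adj_flips[x ab] ->]]] ->; exists x.
exact: Theta_class_flip_class.
Qed.

(** A closest pair of vertices u and w in the opposite quadrants (0,0) and
    (1,1) spans the square: u has a neighbour s in (0,1) and a neighbour t in
    (1,0), and the median of s, t, w is the fourth corner. *)
Lemma quadrants_square x y : x <> y -> quadrants x y ->
  exists u s m t, [/\ square M u s m t, flips x u t & flips y u s].
Proof.
move=> xy q.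
have adj_two u v : h u x != h v x -> h u y != h v y -> ~ adj M u v.
  by move=> ux uy /adj_flips[z uv]; apply: xy; rewrite (flips_uniq uv ux) (flips_uniq uv uy).
pose P n := `[< exists u w, [/\ h u x = false, h u y = false, h w x = true,
                                h w y = true & d u w = n] >].
have exP : exists n, P n.
  have [u ux uy] := q false false; have [w wx wy] := q true true.
  by exists (d u w); apply/asboolP; exists u, w.
have [n /asboolP[u [w [ux uy wx wy uw]]] n_min] := ex_minnP exP.
(* Take the median m of u, w and a vertex p of the quadrant (b, ~~ b): it is in
   the quadrant of p and between u and w.  The first step s from u to m leaves
   (0,0), since otherwise s would be closer to w than u. *)
have step b p : h p x = b -> h p y = ~~ b ->
    exists s, [/\ adj M u s, h s x = b & h s y = ~~ b].
  move=> px py; have [m [duw _ _] hm] := median_coord u w p.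
  have mx : h m x = b by rewrite hm /maj ux wx px; case: (b).
  have my : h m y = ~~ b by rewrite hm /maj uy wy py; case: (b).
  case E : (d u m) => [|k].
    by move: mx my ux uy; rewrite (dist0_eq connM E) => -> -> ->.
  have [s us sm] := dist_step connM E; exists s.
  have usm : d u m = d u s + d s m by rewrite E sm (dist1P connM u s).2.
  have sx := between_coord usm (x := x); have sy := between_coord usm (x := y).
  have far : ~ (h s x = false /\ h s y = false).
    case=> sx0 sy0; have : n <= d s w by apply/n_min/asboolP; exists s, w.
    have := dist_triangle connM m s w; move: duw; rewrite uw E -sm.
    by move: (d s w) (d s m) (d m w) => i j l; clear; lia.
  move: sx sy far; rewrite mx my ux uy.
  by case: (b) (h s x) (h s y) => [] [] [] // e1 e2 e3; split=> //;
    first [by case: e3 | by move: (e1 erefl) | by move: (e2 erefl)].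
have [p px py] := q true false; have [p' p'x p'y] := q false true.
have [t [ut tx ty]] := step true p px py.
have [s [us sx sy]] := step false p' p'x p'y.
have [m [stm _ _] hm] := median_coord s t w.
have mx : h m x = true by rewrite hm /maj sx tx wx.
have my : h m y = true by rewrite hm /maj sy ty wy.
have [sm mt] : adj M s m /\ adj M m t.
  have st2 : d s t <= 2.
    have := dist_triangle connM u s t.
    by rewrite (dist_sym connM s u) !(dist1P connM u _).2.
  have sm0 : d s m <> 0 by move=> /(dist0_eq connM) e; move: mx; rewrite -e sx.
  have mt0 : d m t <> 0 by move=> /(dist0_eq connM) e; move: my; rewrite e ty.
  rewrite -!(dist1P connM); move: stm st2 sm0 mt0; clear.
  by move: (d s t) (d s m) (d m t); lia.
exists u, s, m, t; split.
- split; first by split=> //; apply: adj_sym.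
  split; first by move=> e; move: mx; rewrite -e ux.
  + by move=> e; move: sx; rewrite e tx.
  + by apply: adj_two; rewrite ?ux ?mx ?uy ?my.
  + by apply: adj_two; rewrite ?sx ?tx ?sy ?ty.
- have [z fz] := (adj_flips u t).1 ut.
  by rewrite (@flips_uniq z x u t) // ux tx.
- have [z fz] := (adj_flips u s).1 us.
  by rewrite (@flips_uniq z y u s) // uy sy.
Qed.

(** The coordinate x is flipped an even number of times around the square, but
    not by two consecutive edges, so by two opposite ones; likewise y, and no
    edge flips both. *)
Lemma square_quadrants x y u s m t : x <> y -> square M u s m t ->
  (square_edges u s m t `&` flip_class x) !=set0 ->
  (square_edges u s m t `&` flip_class y) !=set0 -> quadrants x y.
Proof.
move=> xy [[us sm mt tu] [um st _ _]].
have flip2 z a b c : adj M a b -> adj M b c -> a <> c ->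
    ~~ ((h a z != h b z) && (h b z != h c z)).
  move=> /adj_flips[i ab] /adj_flips[j bc] ac; apply/negP => /andP[za zb].
  apply: ac; apply: (@flips_trans z a b c); first by rewrite (flips_uniq ab za).
  by rewrite (flips_uniq bc zb).
have flip1 a b : adj M a b -> ~~ ((h a x != h b x) && (h a y != h b y)).
  move=> /adj_flips[i ab]; apply/negP => /andP[xa ya].
  by apply: xy; rewrite (flips_uniq ab xa) (flips_uniq ab ya).
have edge_flip z : (square_edges u s m t `&` flip_class z) !=set0 ->
    [|| h u z != h s z, h s z != h m z, h m z != h t z | h t z != h u z].
  have key a b p : [set a; b] = [set p.1; p.2] -> flips z p.1 p.2 -> h a z != h b z.
    move=> ep zp; have := zp z; rewrite eqxx.
    by case: (set2_eq ep) => -[-> ->]; case: (h p.1 z) (h p.2 z) => [] [].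
  case=> e [sqe [p ep zp]].
  by case: sqe => ee; rewrite ee in ep; rewrite (key _ _ _ ep zp) ?orbT.
move=> /edge_flip ex /edge_flip ey b c.
have mu z := flip2 z _ _ _ us sm um; have mu' z := flip2 z _ _ _ mt tu (nesym um).
have ts z := flip2 z _ _ _ sm mt st; have ts' z := flip2 z _ _ _ tu us (nesym st).
apply: contrapT => no.
have {no} no v : ~~ ((h v x == b) && (h v y == c)).
  by apply/negP => /andP[/eqP vx /eqP vy]; apply: no; exists v.
move: (flip1 _ _ us) (flip1 _ _ sm) (flip1 _ _ mt) (flip1 _ _ tu).
move: (mu x) (mu y) (mu' x) (mu' y) (ts x) (ts y) (ts' x) (ts' y) ex ey.
move: (no u) (no s) (no m) (no t); clear no.
case: (h u x) (h s x) (h m x) (h t x) => [] [] [] [] //=;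
case: (h u y) (h s y) (h m y) (h t y) => [] [] [] [] //=;
by case: b c => [] [].
Qed.

Lemma cross_adj_quadrants x y (C D : Theta_classes M) :
  (exists u v, flips x u v) -> val C = flip_class x -> val D = flip_class y ->
  cross_adj C D <-> x <> y /\ quadrants x y.
Proof.
move=> [a [b xab]] eC eD; split=> [[CD [u [s [m [t [sq]]]]]]|[xy q]].
  rewrite eC eD => nx ny; have xy : x <> y.
    by move=> xy; apply: CD; apply: val_inj; rewrite eC eD xy.
  by split=> //; apply: (square_quadrants xy sq).
split=> [CD|].
  by apply: xy; apply: (flip_class_inj xab); rewrite -eC -eD CD.
have [u [s [m [t [sq ut us]]]]] := quadrants_square xy q.
exists u, s, m, t; split=> //.
  rewrite eC; exists [set t; u]; split; first by constructor 4.
  by exists (t, u) => //; apply: flips_sym.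
by rewrite eD; exists [set u; s]; split; [constructor 1|exists (u, s)].
Qed.

End Coordinates.

Theorem crossing_coordinates_iso (V : finType) (X : sgraph V) (W : Type)
    (M : sgraph W) (h : W -> V -> bool) :
  median_graph M -> crossing_coordinates M h X -> graph_iso (cross M) X.
Proof.
move=> medM [isoM nc crossM]; apply: graph_iso_sym.
have fl x := flips_exists medM isoM (nc x).
have cl x : Theta_classes M (flip_class h x).
  by have [u [v /(flip_class_Theta medM isoM)]] := fl x.
pose F x : Theta_classes M := in_set_type (cl x).
apply: (@graph_iso_inj_surj _ _ _ _ F).
- move=> x y [E]; have [u [v xuv]] := fl x.
  exact: (flip_class_inj medM isoM xuv E).
- move=> [C CP]; have [x E] := Theta_classP medM isoM (set_mem CP).
  by exists x; apply: val_inj.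
by move=> x y; rewrite crossM -(cross_adj_quadrants medM isoM (C := F x) (D := F y)).
Qed.

(** The coordinate x of v tells whether v is closer to the first endpoint of a
    chosen edge of the class x.  The isometry is proved along a geodesic: the
    class flipped by its first edge has the rest of the geodesic on one side. *)
Theorem median_crossing_coordinates (V : finType) (X : sgraph V) (W : Type)
    (M : sgraph W) :
  median_graph M -> graph_iso (cross M) X ->
  exists h : W -> V -> bool, crossing_coordinates M h X.
Proof.
move=> medM [f [g fK gK] fE]; have connM := medM.1.
have rep x : exists p : W * W, adj M p.1 p.2 /\
    val (g x) = [set e | Theta M [set p.1; p.2] e].
  have [_ [a [b [ab ->]]] ->] := set_mem (valP (g x)).
  by exists (a, b).
have {rep} [p /all_and2[adjp gE]] := choice rep.
pose h v x := closer M (p x).1 (p x).2 v.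
have edge_sep u v : adj M u v -> closer M u v u != closer M u v v.
  move=> uv; rewrite (closer_refl medM uv).
  by have := closer_refl medM (adj_sym uv); rewrite (closerC medM v uv) => /negPf ->.
have sep_class x u v : adj M u v -> h u x != h v x ->
    val (g x) = [set e | Theta M [set u; v] e].
  move=> uv sep; rewrite gE; apply/seteqP.
  have sepE := separates_eq medM _ _ (adjp x) uv sep.
  by split=> e /= /[dup] -[_ [_ [c [k [_ ck _ -> _]]]]];
    rewrite !Theta_separates // sepE.
have adj_flip u v : adj M u v -> exists x, flips h x u v.
  move=> uv.
  have Cuv : Theta_classes M [set e | Theta M [set u; v] e].
    by exists [set u; v] => //; exists u, v.
  pose x := f (in_set_type Cuv).
  have gx : val (g x) = [set e | Theta M [set u; v] e] by rewrite /x fK.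
  have xuv : h u x != h v x.
    apply/(Theta_separates medM (adjp x) uv).
    have : val (g x) [set u; v] by rewrite gx; apply/Theta_separates/edge_sep.
    by rewrite gE.
  exists x => y; have [->|/eqP yx] := eqVneq y x.
    by move: xuv; case: (h u x) (h v x) => [] [].
  apply/negbTE/negP => yuv; apply: yx; apply: (can_inj gK); apply: val_inj.
  by rewrite gx (@sep_class y u v) //; move: yuv; case: (h u y) (h v y) => [] [].
have isoM : isometric M h.
  move=> u v; move En : (dist M u v) => n; elim: n u En => [|n IHn] u uv.
    by rewrite (dist0_eq connM uv) /hamming big1 // => x _; rewrite addbb.
  have [w uw wv] := dist_step connM uv.
  have [x xuw] := adj_flip u w uw.
  have wu := adj_sym uw.
  (* The halfspaces of the class x are those of the edge uw, and v is on the
     side of w. *)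
  have xw : h w x = h v x.
    have xwu : h w x != h u x.
      by move: (xuw x); rewrite eqxx; case: (h u x) (h w x) => [] [].
    have := separates_eq medM w v (adjp x) wu xwu.
    have -> : closer M w u v by rewrite /closer !(dist_sym connM v) uv wv.
    by rewrite (closer_refl medM wu) => /negbFE/eqP.
  rewrite (IHn w wv) /hamming (bigD1 x) //= [in RHS](bigD1 x) //= -xw addbb.
  rewrite xuw eqxx add1n add0n; congr _.+1; apply: eq_bigr => y /negPf yx.
  by move: (xuw y); rewrite yx; case: (h u y) (h w y) => [] [].
have fl x : flips h x (p x).1 (p x).2.
  have [z zp] := adj_flip _ _ (adjp x).
  by rewrite {1}(flips_uniq zp (y := x)) // edge_sep.
exists h; split=> //.
  by move=> x; exists (p x).1, (p x).2; apply: edge_sep.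
move=> x y; have gxE z : val (g z) = flip_class h z.
  by rewrite gE (Theta_class_flip_class medM isoM (fl z)).
rewrite -(cross_adj_quadrants medM isoM _ (gxE x) (gxE y)) //; last first.
  by exists (p x).1, (p x).2.
have := fE (g x) (g y); rewrite !gK => <-; exact: iff_refl.
Qed.

(** * Uniqueness when no star separates *)

(** The Helly property of halfspaces.  Given three elements of s and vertices
    agreeing with t on s except at one of the three respectively, any element of
    s is handled by two of these vertices, so their median agrees with t on s. *)
Lemma pairwise_realized (V : finType) (W : Type) (M : sgraph W)
    (h : W -> V -> bool) (t : V -> bool) :
  median_graph M -> isometric M h ->
  (forall x y, exists v, h v x = t x /\ h v y = t y) -> exists v, h v =1 t.
Proof.
move=> medM isoM pairs.
suff real n (s : seq V) : size s <= n -> exists v, {in s, h v =1 t}.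
  have [v vt] := real _ _ (leqnn (size (enum V))).
  by exists v => x; apply: vt; rewrite mem_enum.
elim: n s => [|n IHn] [|x [|y [|z s]]] //= sn.
- by have [v0] := medM.1.1; exists v0.
- by have [v0] := medM.1.1; exists v0.
- by have [v [vx _]] := pairs x x; exists v => i; rewrite inE => /eqP ->.
- have [v [vx vy]] := pairs x y; exists v => i.
  by rewrite !inE => /orP[] /eqP ->.
have [v1 v1t] : exists v, {in [:: y, z & s], h v =1 t} by apply: IHn.
have [v2 v2t] : exists v, {in [:: x, z & s], h v =1 t} by apply: IHn.
have [v3 v3t] : exists v, {in [:: x, y & s], h v =1 t} by apply: IHn.
have [m _ hm] := median_coord medM isoM v1 v2 v3.
exists m => i; rewrite hm /maj !inE => /or4P[/eqP ->|/eqP ->|/eqP ->|si].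
- by rewrite (v2t x) ?(v3t x) ?inE ?eqxx //; case: (t x); rewrite ?andbT ?andbF ?orbT.
- by rewrite (v1t y) ?(v3t y) ?inE ?eqxx ?orbT //; case: (t y); rewrite ?andbT ?andbF ?orbT.
- by rewrite (v1t z) ?(v2t z) ?inE ?eqxx ?orbT //; case: (t z); rewrite ?andbT ?andbF ?orbT.
- by rewrite v1t ?v2t ?v3t ?inE ?si ?orbT //; case: (t i).
Qed.

Section Sides.
Variables (V : finType) (X : sgraph V) (W : Type) (M : sgraph W).
Variable h : W -> V -> bool.
Hypotheses (medM : median_graph M) (coordM : crossing_coordinates M h X).
Let isoM := coord_isometric coordM.

Lemma coord_flips x : exists u v, flips h x u v.
Proof. exact/(flips_exists medM isoM)/(coord_nonconstant coordM). Qed.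

Lemma flips_other x y a b : flips h x a b -> y <> x -> h a y = h b y.
Proof. by move=> /(_ y) + /eqP/negPf yx; rewrite yx; case: (h a y) (h b y) => [] []. Qed.

Lemma flips_value x a b c : flips h x a b -> h a x = c \/ h b x = c.
Proof.
move=> /(_ x); rewrite eqxx.
by case: (h a x) (h b x) c => [] [] [] //; auto.
Qed.

(** The edge ab has its ends on both sides of y and on one side of x, so two
    quadrants on that side are occupied.  One of the other two is empty, hence
    some side of y is contained in a side of x. *)
Lemma uncrossed_side x y a b : x <> y -> ~ adj X x y -> flips h y a b ->
  exists c, forall v, h v y = c -> h v x = h a x.
Proof.
move=> xy nxy yab; apply: contrapT => no; apply: nxy.
apply/(coord_crossing coordM); split=> // e c.
have [->|] := eqVneq e (h a x).
  have [ya|yb] := flips_value c yab; first by exists a.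
  by exists b => //; rewrite (flips_other yab).
move=> eN; apply: contrapT => no'; apply: no; exists c => v vc.
apply/eqP/negPn/negP => vN; apply: no'; exists v => //.
by move: eN vN; case: e (h v x) (h a x) => [] [] [].
Qed.

(** If y and z cross, a vertex in the sides of y and z given by
    [uncrossed_side] shows that these are on the same side of x. *)
Lemma uncrossed_side_adj x y z a b c e :
  x <> y -> ~ adj X x y -> x <> z -> ~ adj X x z -> y = z \/ adj X y z ->
  flips h y a b -> flips h z c e -> h a x = h c x.
Proof.
move=> xy nxy xz nxz yz yab zce.
have [p ph] := uncrossed_side xy nxy yab.
case: yz => [eyz|/(coord_crossing coordM)[_ q]]; last first.
  have [p' ph'] := uncrossed_side xz nxz zce.
  by have [v vy vz] := q p p'; rewrite -(ph v) // (ph' v).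
rewrite -eyz in zce; have [cp|ep] := flips_value p zce; first by rewrite ph.
by rewrite (flips_other zce xy) ph.
Qed.

(** Along a walk that avoids star(x), consecutive classes lie on the same side
    of x by [uncrossed_side_adj].  If star(x) is everything, either value of o
    will do. *)
Lemma connected_side x : ~ star_separates X x ->
  exists o, forall y a b, x <> y -> ~ adj X x y -> flips h y a b -> h a x = o.
Proof.
move=> nsep.
have conn (y z : (~` star X x : set V)) : exists n, walk (induced X (~` star X x)) n y z.
  apply: contrapT => nyz; apply: nsep.
  exists [set t | exists n, walk (induced X (~` star X x)) n y t].
  exists [set t | exists n, walk (induced X (~` star X x)) n z t].
  split; [by exists y|by exists z|].
  move=> E; apply: nyz; change ([set t | exists n, walk (induced X (~` star X x)) n y t] z).
  by rewrite E; exists 0.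
have out y : x <> y -> ~ adj X x y -> (~` star X x) y.
  by move=> xy nxy [yx|] //; apply: xy.
have in_out (y : (~` star X x : set V)) : x <> val y /\ ~ adj X x (val y).
  by have := set_mem (valP y) => /= ny; split=> [E|E]; apply: ny; [left|right].
have side (y z : (~` star X x : set V)) a b c e :
    flips h (val y) a b -> flips h (val z) c e -> h a x = h c x.
  have [n] := conn y z; elim: n y a b => [|n IHn] y a b.
    move=> -> yab zce; have [xz nxz] := in_out z.
    by apply: (uncrossed_side_adj xz nxz xz nxz _ yab zce); left.
  case=> w yw wz yab zce; have [i [j wij]] := coord_flips (val w).
  have [xy nxy] := in_out y; have [xw nxw] := in_out w.
  rewrite (uncrossed_side_adj xy nxy xw nxw _ yab wij); last by right.
  exact: IHn wz wij zce.
have [[y0 [xy0 nxy0]]|none] := pselect (exists y, x <> y /\ ~ adj X x y).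
  have [a0 [b0 ab0]] := coord_flips y0.
  exists (h a0 x) => y a b xy nxy yab.
  exact: (side (in_set_type (out _ xy nxy)) (in_set_type (out _ xy0 nxy0)) _ _ _ _ yab ab0).
by exists true => y a b xy nxy; case: none; exists y.
Qed.

Theorem iso_simp : (forall x, ~ star_separates X x) -> graph_iso M (simp X).
Proof.
move=> nsep; have [o oP] := choice (fun x => connected_side (nsep x)).
have nadj_sym x y : ~ adj X x y -> ~ adj X y x by move=> nxy yx; apply/nxy/adj_sym.
(* The edges of the class x lie on the side o y of y and reach both sides of
   x. *)
have corner x y c : x <> y -> ~ adj X x y -> exists2 v, h v x = c & h v y = o y.
  move=> xy nxy; have [a [b xab]] := coord_flips x.
  have ay := oP y x a b (nesym xy) (nadj_sym _ _ nxy) xab.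
  have [ac|bc] := flips_value c xab; first by exists a.
  by exists b => //; rewrite -(flips_other xab (nesym xy)).
(* Some quadrant of x and y is empty.  It is the one opposite to (o x, o y),
   because the edges of the classes x and y reach the three others. *)
have away x y v : x <> y -> ~ adj X x y -> h v x != o x -> h v y = o y.
  move=> xy nxy vx; have [a [b yab]] := coord_flips y.
  have [c cP] := uncrossed_side xy nxy yab.
  have [w wx wy] := corner x y (~~ o x) xy nxy.
  have oc : o y != c.
    apply/eqP => oc; have := cP w; rewrite wy wx (oP x y a b) // => /(_ oc).
    by case: (o x).
  have : h v y != c.
    by apply: contraNN vx => /eqP /cP ->; apply/eqP/(oP x y a b).
  by move: oc; case: (h v y) (o y) c {cP} => [] [] [].
pose K v := [set x | h v x != o x]%SET.
have KP v : cliques X (K v).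
  move=> x y; rewrite !inE => vx vy xy; apply: contrapT => nxy.
  by move: vy; rewrite (away x y) ?eqxx.
apply: (@graph_iso_inj_surj _ _ _ _ (fun v => in_set_type (KP v))).
- move=> u v [E]; apply: (coord_inj medM isoM) => x.
  move/setP/(_ x): E; rewrite !inE.
  by case: (h u x) (h v x) (o x) => [] [] [].
- move=> L; have cL := set_mem (valP L).
  have [|v vL] := @pairwise_realized _ _ _ h (fun x => o x (+) (x \in val L)) medM isoM.
    move=> x y; have [<-|/eqP xy] := eqVneq x y.
      have [a [b xab]] := coord_flips x.
      by have [] := flips_value (o x (+) (x \in val L)) xab; [exists a|exists b].
    have [xy1|nxy] := pselect (adj X x y).
      have [_ q] := (coord_crossing coordM x y).1 xy1.
      by have [v] := q (o x (+) (x \in val L)) (o y (+) (y \in val L)); exists v.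
    case yL : (y \in val L); last first.
      have [v] := corner x y (o x (+) (x \in val L)) xy nxy.
      by exists v; rewrite addbF.
    case xL : (x \in val L); first by case: nxy; apply: cL.
    have [v] := corner y x (o y (+) true) (nesym xy) (nadj_sym _ _ nxy).
    by exists v; rewrite addbF.
  exists v; apply: val_inj; apply/setP => x; rewrite inE vL.
  by case: (o x); case: (x \in val L).
move=> u v; rewrite (adj_flips medM isoM) [adj _ _ _]toggle_finsetP /=.
have E y : (y \in K u) (+) (y \in K v) = h u y (+) h v y.
  by rewrite !inE; case: (h u y) (h v y) (o y) => [] [] [].
by split=> -[x xuv]; exists x => y; have := xuv y; rewrite E.
Qed.

End Sides.

(** * Graphs of set families *)

Definition toggle (V : finType) (x : V) (K : {set V}) : {set V} :=
  [set y | (y \in K) (+) (y == x)]%SET.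

Lemma toggle_in (V : finType) (K : {set V}) x :
  x \in K -> toggle x K = (K :\ x)%SET.
Proof.
move=> xK; apply/setP => y; rewrite !inE.
by have [->|_] := eqVneq y x; rewrite ?xK ?addbF.
Qed.

Lemma toggle_notin (V : finType) (K : {set V}) x :
  x \notin K -> toggle x K = (x |: K)%SET.
Proof.
move=> xK; apply/setP => y; rewrite !inE.
by have [->|_] := eqVneq y x; rewrite ?(negPf xK) ?addbF.
Qed.

(** The graph on a family S of sets, with the same adjacency as the simplex
    graph.  It is isometric in the hypercube when one can always move inside S
    towards another member, and median when moreover S is closed under
    majority. *)
Section CubeGraph.
Variables (V : finType) (S : set {set V}).

Definition cube_adj (K L : S) : Prop :=
  exists x, (x \notin val K /\ val L = (x |: val K)%SET) \/
            (x \notin val L /\ val K = (x |: val L)%SET).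

Lemma cube_sym K L : cube_adj K L -> cube_adj L K.
Proof. by case=> x [h|h]; exists x; [right|left]. Qed.

Lemma cube_irrefl K : ~ cube_adj K K.
Proof. by move=> /toggle_finsetP[x /(_ x)]; rewrite addbb eqxx. Qed.

Definition cube_graph : sgraph S := SGraph cube_sym cube_irrefl.

Definition indicator (K : S) (x : V) : bool := x \in val K.

Lemma cube_adjP (K L : S) :
  cube_adj K L <-> exists x, val L = toggle x (val K).
Proof.
rewrite /cube_adj toggle_finsetP; split=> -[x xKL]; exists x.
  by apply/setP => y; rewrite inE -xKL; case: (_ \in _); case: (_ \in _).
by move=> y; rewrite xKL inE; case: (_ \in _); case: (_ == _).
Qed.

Hypothesis S_nonempty : S !=set0.
Hypothesis S_step : forall K L, S K -> S L -> K <> L ->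
  exists2 x, (x \in K) != (x \in L) & S (toggle x K).

Lemma cube_walk_hamming n (K L : S) :
  walk cube_graph n K L -> hamming (indicator K) (indicator L) <= n.
Proof.
elim: n K => [|n IHn] K.
  by move=> ->; rewrite /hamming big1 // => x _; rewrite addbb.
case=> N /toggle_finsetP KN /IHn NL.
have /hamming1P KN1 : exists x, forall y, indicator K y (+) indicator N y = (y == x).
  by [].
apply: leq_trans (hamming_triangle _ _ (indicator N)) _.
by rewrite KN1 add1n.
Qed.

Lemma cube_walk (K L : S) :
  walk cube_graph (hamming (indicator K) (indicator L)) K L.
Proof.
move En : (hamming _ _) => n; elim: n K En => [|n IHn] K KL.
  by apply/val_inj/setP => x; apply: (hamming0P KL).
have [eKL|/eqP nKL] := eqVneq (val K) (val L).
  by move: KL; rewrite /hamming big1 // => x _; rewrite /indicator eKL addbb.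
have [x xKL Sx] := S_step (set_mem (valP K)) (set_mem (valP L)) nKL.
exists (in_set_type Sx); first by apply/cube_adjP; exists x.
apply: IHn; move: KL; rewrite /hamming (bigD1 x) //= [in X in _ -> X](bigD1 x) //=.
rewrite /indicator /= inE eqxx; move: xKL; case: (x \in val K) (x \in val L) => [] [] //= _.
all: rewrite add1n => -[<-]; apply: eq_bigr => y /negPf yx; by rewrite inE yx addbF.
Qed.

Lemma cube_connected : connected_graph cube_graph.
Proof.
split; first by have [K SK] := S_nonempty; exists; exact: in_set_type SK.
by move=> K L; exists (hamming (indicator K) (indicator L)); apply: cube_walk.
Qed.

Lemma cube_isometric : isometric cube_graph indicator.
Proof.
move=> K L; apply/eqP; rewrite eqn_leq; apply/andP; split.
  exact/(dist_min cube_connected)/cube_walk.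
exact/cube_walk_hamming/(dist_walk cube_connected).
Qed.

Hypothesis S_maj : forall K L N, S K -> S L -> S N ->
  S [set x | maj (fun y => y \in K) (fun y => y \in L) (fun y => y \in N) x]%SET.

Lemma cube_median : median_graph cube_graph.
Proof.
split=> [|K L N]; first exact: cube_connected.
have SM := S_maj (set_mem (valP K)) (set_mem (valP L)) (set_mem (valP N)).
exists (in_set_type SM); split=> [|P].
  by rewrite !cube_isometric /hamming -!big_split; split; apply: eq_bigr => x _;
  rewrite /indicator /= inE /maj; case: (x \in val K); case: (x \in val L); case: (x \in val N).
rewrite !cube_isometric => -[/hamming_between KL /hamming_between LN /hamming_between KN].
apply/val_inj/setP => x; rewrite inE.
move: (KL x) (LN x) (KN x); rewrite /indicator /maj.
case: (x \in val K); case: (x \in val L); case: (x \in val N);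
  by move=> e1 e2 e3; first [by rewrite e1|by rewrite e2|by rewrite e3].
Qed.

End CubeGraph.

(** * The simplex graph *)

Section SimplexGraph.
Variables (V : finType) (X : sgraph V).

(** The two graphs differ only in the proofs of symmetry and irreflexivity. *)
Lemma simpE : simp X = cube_graph (cliques X).
Proof. by rewrite /simp /cube_graph; congr SGraph; apply: Prop_irrelevance. Qed.

Lemma sub_clique (K L : {set V}) : K \subset L -> cliques X L -> cliques X K.
Proof. by move=> /fintype.subsetP KL cL x y /KL xL /KL; apply: cL. Qed.

Lemma clique0 : cliques X finset.set0.
Proof. by move=> x y; rewrite inE. Qed.

Lemma clique1 x : cliques X [set x]%SET.
Proof. by move=> y z; rewrite !inE => /eqP -> /eqP ->. Qed.

Lemma cliques_nonempty : cliques X !=set0.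
Proof. by exists finset.set0; apply: clique0. Qed.

Lemma cliques_step K L : cliques X K -> cliques X L -> K <> L ->
  exists2 x, (x \in K) != (x \in L) & cliques X (toggle x K).
Proof.
move=> cK cL KL; case: (boolP (K \subset L)) => [sKL|/subsetPn[x xK xL]].
  have /subsetPn[x xL xK] : ~~ (L \subset K).
    by apply: contra_notN KL => LK; apply/eqP; rewrite finset.eqEsubset sKL.
  exists x; first by rewrite xL (negPf xK).
  by rewrite toggle_notin //; apply: sub_clique cL; rewrite finset.subUset finset.sub1set xL.
exists x; first by rewrite xK (negPf xL).
by rewrite toggle_in //; apply: sub_clique cK; apply: finset.subsetDl.
Qed.

Lemma cliques_maj K L N : cliques X K -> cliques X L -> cliques X N ->
  cliques X [set x | maj (fun y => y \in K) (fun y => y \in L) (fun y => y \in N) x]%SET.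
Proof.
move=> cK cL cN x y; rewrite !inE.
have := maj_pair (fun y => y \in K) (fun y => y \in L) (fun y => y \in N) x y.
by case=> /= -[-> ->]; auto.
Qed.

Lemma simp_median : median_graph (simp X).
Proof.
rewrite simpE; apply: cube_median;
  [exact: cliques_nonempty|exact: cliques_step|exact: cliques_maj].
Qed.

Lemma simp_coordinates :
  crossing_coordinates (cube_graph (cliques X)) (@indicator V (cliques X)) X.
Proof.
split.
- exact/cube_isometric/cliques_step/cliques_nonempty.
- move=> x; exists (in_set_type (@clique1 x)), (in_set_type clique0).
  by rewrite /indicator /= !inE eqxx.
move=> x y; split=> [xy|[xy q]]; last first.
  have [K] := q true true; rewrite /indicator => xK yK.
  exact: (set_mem (valP K)).
have neq : x <> y by move=> E; move: xy; rewrite E; apply: adj_irrefl.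
have cxy : cliques X [set x; y]%SET.
  move=> u v; rewrite !inE => /orP[] /eqP -> /orP[] /eqP -> // _.
  exact: adj_sym.
split=> // b c.
have cK : cliques X [set z in [set x; y] | (b && (z == x)) || (c && (z == y))]%SET.
  by apply: sub_clique cxy; apply/fintype.subsetP => z; rewrite !inE => /andP[].
move: neq => /eqP/negPf neq.
exists (in_set_type cK); rewrite /indicator /= !inE !eqxx ?(eq_sym y) neq;
  by case: b c {cK} => [] [].
Qed.

Lemma simp_cross : graph_iso (cross (simp X)) X.
Proof.
have := simp_median; rewrite simpE => med.
exact: crossing_coordinates_iso med simp_coordinates.
Qed.

End SimplexGraph.

(** * Degrees *)

Section Degree.

Lemma degree_le_iso (V W : Type) (G : sgraph V) (H : sgraph W) k :
  graph_iso G H -> degree_le G k -> degree_le H k.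
Proof.
case=> f [g fK gK] fE degG w; apply: card_le_trans (degG (g w)).
apply: card_le_trans (card_image_le f _); apply: subset_card_le => u wu.
by exists (g u); rewrite ?gK //=; apply/fE; rewrite !gK.
Qed.

Lemma is_degree_iso (V W : Type) (G : sgraph V) (H : sgraph W) k :
  graph_iso G H -> is_degree G k -> is_degree H k.
Proof.
move=> GH [degG minG]; split; first exact: degree_le_iso degG.
by move=> l degH; apply/minG/degree_le_iso/degH/graph_iso_sym.
Qed.

Lemma degree_le_attained (V : Type) (G : sgraph V) k :
  degree_le G k -> exists2 l, is_degree G l & l <= k.
Proof.
move=> degG; have exP : exists l, `[< degree_le G l >] by exists k; apply/asboolP.
have [l /asboolP degl l_min] := ex_minnP exP.
exists l; last exact/l_min/asboolP.
by split=> // m degm; apply/l_min/asboolP.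
Qed.

Variable V : finType.

(** The neighbours of K are obtained from K by toggling elements of T. *)
Lemma cube_degree_le (S : set {set V}) n :
  (forall K, S K -> exists2 T : {set V}, #|T| <= n &
    forall x, S (toggle x K) -> x \in T) ->
  degree_le (cube_graph S) n.
Proof.
move=> free K; have [T Tn TP] := free _ (set_mem (valP K)).
(* Outside the indices of the possible neighbours, F takes the dummy value K. *)
pose F i := if onth (enum T) i is Some x then
  if pselect (S (toggle x (val K))) is left p then in_set_type p else K else K.
apply: card_le_trans (card_image_le F _); apply: subset_card_le => L /cube_adjP[x xKL].
have Sx : S (toggle x (val K)) by rewrite -xKL; exact: set_mem (valP L).
have xT : x \in enum T by rewrite mem_enum TP.
exists (index x (enum T)) => /=.
  by apply: leq_trans Tn; rewrite cardE index_mem.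
rewrite /F onthE (nth_map x) ?index_mem // nth_index //.
by case: pselect => // p; apply: val_inj.
Qed.

Lemma simp_degree (X : sgraph V) : is_degree (simp X) #|V|.
Proof.
split.
  rewrite simpE; apply: cube_degree_le => K _; exists [set: V]%SET => //.
  by rewrite cardsT.
(* The singletons are |V| distinct neighbours of the empty clique. *)
move=> k deg; rewrite -card_le_II.
apply: card_le_trans (deg (in_set_type (@clique0 _ X))).
pose D (L : cliques X) := if [pick x in val L] is Some x then enum_rank x : nat else 0.
apply: card_le_trans (card_image_le D _); apply: subset_card_le => i /= iV.
pose x := enum_val (Ordinal iV).
exists (in_set_type (@clique1 _ X x)).
  by exists x; left; rewrite inE finset.setU0.
rewrite /D /=; case: pickP => [y|/(_ x)]; rewrite inE ?eqxx // => /eqP ->.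
by rewrite enum_valK.
Qed.

End Degree.

(** * Splitting along a separating star *)

Section SplitGraph.
Variables (V : finType) (X : sgraph V) (x : V) (B : {set V}).

(** B should meet the complement of star(x) in a union of components; let A be
    the rest of this complement.  A member of the family that contains x avoids
    A, and one that does not contain x avoids B.  So the Theta-class x separates
    the classes in A from those in B, while in the simplex graph it has all of
    them on the side of the cliques without x. *)
Definition split_sets : set {set V} := [set K |
  (forall y z, y \in K -> z \in K -> y <> x -> z <> x -> y <> z -> adj X y z) /\
  (forall y, y \in K -> y <> x -> ~ adj X x y -> (y \in B) = (x \in K))].

Lemma split_sub (K L : {set V}) : split_sets L ->
  (forall y, y \in K -> y <> x -> y \in L) -> (x \in K) = (x \in L) ->
  split_sets K.
Proof.
move=> [cL sL] KL xKL; split=> [y z yK zK yx zx|y yK yx]; first by apply: cL; auto.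
by rewrite xKL; apply: sL; auto.
Qed.

Lemma split0 : split_sets finset.set0.
Proof. by split=> [y z|y]; rewrite inE. Qed.

Lemma split_nonempty : split_sets !=set0.
Proof. by exists finset.set0; apply: split0. Qed.

Lemma split_step K L : split_sets K -> split_sets L -> K <> L ->
  exists2 y, (y \in K) != (y \in L) & split_sets (toggle y K).
Proof.
move=> SK SL KL.
case: (boolP (K :\ x \subset L)%SET) => [/fintype.subsetP KxL|/subsetPn[y]]; last first.
  rewrite !inE => /andP[yx yK] yL; exists y; first by rewrite yK (negPf yL).
  apply: split_sub SK _ _ => [z|]; first by rewrite toggle_in // !inE => /andP[].
  by rewrite inE (eq_sym x) (negPf yx) addbF.
have {}KxL z : z \in K -> z <> x -> z \in L.
  by move=> zK /eqP zx; apply: KxL; rewrite !inE zx.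
have [xKL|xKL] := eqVneq (x \in K) (x \in L); last first.
  exists x => //; apply: split_sub SL _ _ => [z|].
    rewrite inE => + zx; have /negPf -> : z != x by apply/eqP.
    by rewrite addbF => /KxL; apply.
  by rewrite inE eqxx; move: xKL; case: (_ \in _); case: (_ \in _).
have /subsetPn[y yL yK] : ~~ (L \subset K).
  apply: contra_notN KL => LK; apply/eqP; rewrite finset.eqEsubset LK andbT.
  apply/fintype.subsetP => z zK; have [zx|/eqP zx] := eqVneq z x; last exact: KxL.
  by rewrite zx -xKL -zx.
exists y; first by rewrite yL (negPf yK).
have yx : (x == y) = false by apply/eqP => E; move: yL yK; rewrite -E xKL => ->.
apply: split_sub SL _ _ => [z|]; last by rewrite inE yx addbF.
by rewrite toggle_notin // !inE => /orP[/eqP ->|/KxL] //; auto.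
Qed.

Lemma split_maj K L N : split_sets K -> split_sets L -> split_sets N ->
  split_sets [set y | maj (fun y => y \in K) (fun y => y \in L) (fun y => y \in N) y]%SET.
Proof.
move=> [cK sK] [cL sL] [cN sN]; split=> [y z|y]; rewrite !inE.
  by case: (maj_pair (fun y => y \in K) (fun y => y \in L) (fun y => y \in N) y z) => /= -[-> ->]; auto.
by case: (maj_pair (fun y => y \in K) (fun y => y \in L) (fun y => y \in N) y x) => /= -[-> ->]; auto.
Qed.

(** Letting p and q vary gives a square in the directions y and z (or, for
    y = z, an edge) on a side b of x on which both y and z are allowed. *)
Lemma split_small y z b p q : y <> x -> z <> x -> y = z \/ adj X y z ->
  (~ adj X x y -> (y \in B) = b) -> (~ adj X x z -> (z \in B) = b) ->
  split_sets [set w | [|| b && (w == x), p && (w == y) | q && (w == z)]]%SET.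
Proof.
move=> /eqP/negPf yx /eqP/negPf zx yz yB zB.
split=> [u v|u]; rewrite !inE.
  case/or3P=> /andP[_ /eqP ->] // + ux; case/or3P=> /andP[_ /eqP ->] // _ //.
    by case: yz => [->|].
  by case: yz => [->|yz _] //; apply: adj_sym.
rewrite eqxx !(eq_sym x) yx zx !andbF !orbF andbT.
by case/or3P=> /andP[_ /eqP ->].
Qed.

Hypothesis B_closed : forall y z, y <> x -> ~ adj X x y -> z <> x ->
  ~ adj X x z -> adj X y z -> (y \in B) = (z \in B).

Lemma split_coordinates :
  crossing_coordinates (cube_graph split_sets) (@indicator V split_sets) X.
Proof.
have small1 y b p : y <> x -> (~ adj X x y -> (y \in B) = b) ->
    split_sets [set w | [|| b && (w == x), p && (w == y) | p && (w == y)]]%SET.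
  by move=> yx yB; apply: split_small => //; left.
split.
- exact/cube_isometric/split_step/split_nonempty.
- move=> y; have [->|/eqP yx] := eqVneq y x.
    have S1 : split_sets [set x]%SET.
      by split=> [u v|u]; rewrite !inE => /eqP ->.
    by exists (in_set_type split0), (in_set_type S1); rewrite /indicator /= !inE eqxx.
  have Sp p := small1 y (y \in B) p yx (fun=> erefl).
  exists (in_set_type (Sp true)), (in_set_type (Sp false)).
  by rewrite /indicator /= !inE eqxx; move/eqP/negPf: yx => ->; rewrite andbF.
move=> y z; split=> [yz|[yz q]]; last first.
  (* A class that does not cross x can be added on one side of x only. *)
  have [xE|/eqP yx] := eqVneq y x.
    apply: contrapT => nyz.
    have side b : (z \in B) = b.
      have [K] := q b true; rewrite /indicator xE => <- zK.
      have [_ sK] := set_mem (valP K).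
      by apply: sK => //; rewrite -xE //; apply: nesym.
    by have := side true; rewrite (side false).
  have [xE|/eqP zx] := eqVneq z x.
    apply: contrapT => nyz.
    have side b : (y \in B) = b.
      have [K] := q true b; rewrite /indicator xE => yK <-.
      have [_ sK] := set_mem (valP K).
      by apply: sK => //; rewrite -xE // => zy; apply/nyz/adj_sym.
    by have := side true; rewrite (side false).
  have [K] := q true true; rewrite /indicator => yK zK.
  by have [cK _] := set_mem (valP K); apply: cK.
have neq : y <> z by move=> E; move: yz; rewrite E; apply: adj_irrefl.
split=> // b c.
have [yx|/eqP yx] := eqVneq y x.
  have zx : z <> x by rewrite -yx; apply: nesym.
  have xz : adj X x z by rewrite -yx.
  have Sz := small1 z b c zx (fun n => False_ind _ (n xz)).
  exists (in_set_type Sz); rewrite /indicator /= !inE ?yx eqxx.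
    by move/eqP/negPf: zx; rewrite eq_sym => ->; rewrite !andbF !orbF andbT.
  by move/eqP/negPf: zx => ->; rewrite !andbF orbb andbT.
have [zx|/eqP zx] := eqVneq z x.
  have xy : adj X x y by rewrite -zx; apply: adj_sym.
  have Sy := small1 y c b yx (fun n => False_ind _ (n xy)).
  exists (in_set_type Sy); rewrite /indicator /= !inE ?zx eqxx.
    by move/eqP/negPf: yx => ->; rewrite !andbF orbb andbT.
  by move/eqP/negPf: yx; rewrite eq_sym => ->; rewrite !andbF !orbF andbT.
(* As y and z are adjacent, they do not lie in different parts, so a single side
   d of x admits both. *)
have [d yd zd] : exists2 d, ~ adj X x y -> (y \in B) = d & ~ adj X x z -> (z \in B) = d.
  have [xy|nxy] := pselect (adj X x y); first by exists (z \in B).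
  by exists (y \in B) => // nxz; apply/esym/B_closed.
have S' := split_small b c yx zx (or_intror yz) yd zd.
exists (in_set_type S'); rewrite /indicator /= !inE eqxx.
  by move/eqP/negPf: yx => ->; move/eqP/negPf: neq => ->; rewrite !andbF orbF andbT.
move/eqP/negPf: zx => ->; rewrite eq_sym; move/eqP/negPf: neq => ->.
by rewrite !andbF andbT.
Qed.

Lemma split_median : median_graph (cube_graph split_sets).
Proof.
by apply: cube_median; [exact: split_nonempty|exact: split_step|exact: split_maj].
Qed.

Lemma split_cross : graph_iso (cross (cube_graph split_sets)) X.
Proof. exact: crossing_coordinates_iso split_median split_coordinates. Qed.

(** On the side of x that K is on, one of y and z cannot be added to K. *)
Lemma split_degree y z :
  y <> x -> ~ adj X x y -> y \in B -> z <> x -> ~ adj X x z -> z \notin B ->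
  degree_le (cube_graph split_sets) #|V|.-1.
Proof.
move=> yx nxy yB zx nxz zB; apply: cube_degree_le => K [_ sK].
have blocked w : w <> x -> ~ adj X x w -> (w \in B) != (x \in K) ->
    exists2 T : {set V}, #|T| <= #|V|.-1 &
      forall u, split_sets (toggle u K) -> u \in T.
  move=> wx nxw wB; exists [set~ w]%SET; first by rewrite cardsC1.
  move=> u [_ sT]; rewrite !inE; apply/eqP => uw.
  have := sT w; rewrite !inE uw eqxx.
  have wK : w \notin K by apply/negP => wK; move: wB; rewrite (sK w) ?eqxx.
  rewrite (negPf wK) => /(_ isT wx nxw) wB'.
  have /negPf xw : x != w by apply/eqP/nesym.
  by move: wB; rewrite wB' xw addbF eqxx.
case xK : (x \in K).
  by apply: (blocked z); rewrite // xK (negPf zB).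
by apply: (blocked y); rewrite // xK yB.
Qed.

End SplitGraph.

Lemma star_separates_mdeg (V : finType) (X : sgraph V) x :
  star_separates X x -> ~ is_mdeg X #|V|.
Proof.
case=> _ [_ [[y ->] [z ->] CD]] [_ mdeg].
set Y := induced X (~` star X x) in y z CD.
(* One part is the component of y; the other is the rest, which contains z. *)
pose B := [set t | `[< exists2 u : (~` star X x : set V), val u = t &
                        exists n, walk Y n y u >]]%SET.
have out (u : (~` star X x : set V)) : val u <> x /\ ~ adj X x (val u).
  by have := set_mem (valP u) => /= nu; split=> [E|E]; apply: nu; [left|right].
have B_closed s t : s <> x -> ~ adj X x s -> t <> x -> ~ adj X x t ->
    adj X s t -> (s \in B) = (t \in B).
  wlog suff imp : s t / s <> x -> ~ adj X x s -> t <> x -> ~ adj X x t ->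
      adj X s t -> s \in B -> t \in B.
    move=> sx nxs tx nxt st; apply/idP/idP; first exact: imp.
    by apply: imp => //; apply: adj_sym.
  move=> sx nxs tx nxt st; rewrite !inE => -[u us [n yu]].
  have tout : (~` star X x) t by case.
  exists (in_set_type tout) => //; exists (n + 1); apply: walk_cat yu _.
  by exists (in_set_type tout) => //=; rewrite /induced_adj /= us.
have yB : val y \in B by rewrite !inE; exists y => //; exists 0.
have zB : val z \notin B.
  apply/negP; rewrite !inE => -[u /val_inj -> [n yz]]; apply: CD.
  apply/seteqP; split=> t [k ut].
    by exists (n + k); apply: walk_cat ut; apply: walk_sym.
  by exists (n + k); apply: walk_cat ut.
have [yx nxy] := out y; have [zx nxz] := out z.
have deg := split_degree yx nxy yB zx nxz zB.
have [k kdeg kV] := degree_le_attained deg.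
have := mdeg _ _ _ (split_median X x B) (split_cross B_closed) kdeg.
have : 0 < #|V| by apply/card_gt0P; exists x.
by move: kV; lia.
Qed.

Theorem theorem1p4 (V : finType) (X : sgraph V) :
  let mdeg_eq_card := is_mdeg X #|V| in
  let simp_unique :=
    [/\ median_graph (simp X), graph_iso (cross (simp X)) X &
        forall (W : Type) (M : sgraph W),
          median_graph M -> graph_iso (cross M) X -> graph_iso M (simp X)] in
  let no_separating_star := ~ exists x : V, star_separates X x in
  (mdeg_eq_card <-> simp_unique) /\ (simp_unique <-> no_separating_star).
Proof.
move=> mdeg_eq_card simp_unique no_separating_star.
have unique_mdeg : simp_unique -> mdeg_eq_card.
  case=> med crossX uniq; split.
    by exists (cliques X), (simp X); split=> //; apply: simp_degree.
  move=> W M k medM crossM degM.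
  have [_ minS] := simp_degree X.
  by have [degk _] := is_degree_iso (uniq W M medM crossM) degM; apply: minS.
have mdeg_star : mdeg_eq_card -> no_separating_star.
  by move=> mdeg [x sep]; apply: star_separates_mdeg sep mdeg.
have star_unique : no_separating_star -> simp_unique.
  move=> nsep; split; [exact: simp_median|exact: simp_cross|].
  move=> W M medM crossM; have [h coordM] := median_crossing_coordinates medM crossM.
  by apply: (iso_simp medM coordM) => x sep; apply: nsep; exists x.
by split; split; auto.
Qed.
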